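(* Let $n\ge 2$ and let $K$ and $L$ be two convex bodies in $\mathbb{R}^n$ such that $0\in \mathrm{int}(K)\cap\mathrm{int}(L)$ and for every $\xi\in S^{n-1}$ there exists a rotation $\varphi_\xi\in SO(n-1,\xi^\perp)$ such that $$\varphi_\xi(K|\xi^\perp)\subseteq L|\xi^\perp.$$ Then $\mathrm{vol}_n(K^* )\ge \mathrm{vol}_n(L^* )$.
   Context: A convex body is a compact convex set with non-empty interior; $\mathrm{int}$ denotes interior. For $\xi\in S^{n-1}$, $\xi^\perp=\{x\in\mathbb{R}^n: x\cdot\xi=0\}$ and $K|\xi^\perp$ is the orthogonal projection of $K$ onto $\xi^\perp$. $SO(n-1,\xi^\perp)$ is the group of rotations of the hyperplane $\xi^\perp$ around the origin (equivalently, restrictions to $\xi^\perp$ of rotations $\Phi\in SO(n)$ with $\Phi(\xi)=\xi$). The polar body of $K$ is $K^*=\{x\in\mathbb{R}^n: x\cdot y\le 1 \text{ for every } y\in K\}$. $\mathrm{vol}_n$ is $n$-dimensional Lebesgue measure. *)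

(* Defs.v *)
(* R^n is 'rV[R]_n, for an arbitrary R : realType. *)
From HB Require Import structures.
From mathcomp Require Import all_boot all_order all_algebra.
From mathcomp Require Import all_classical all_reals all_analysis.
Set Implicit Arguments.
Unset Strict Implicit.
Unset Printing Implicit Defensive.
Import Order.TTheory GRing.Theory Num.Theory.
Import numFieldNormedType.Exports.
Local Open Scope classical_set_scope.
Local Open Scope ring_scope.

Definition dot (R : realType) (n : nat) (x y : 'rV[R]_n) : R :=
  (x *m y^T) 0 0.

(* The library's `|x| on 'rV[R]_n is the sup norm. *)
Definition enorm (R : realType) (n : nat) (x : 'rV[R]_n) : R :=
  Num.sqrt (dot x x).

Definition sphere (R : realType) (n : nat) : set 'rV[R]_n :=
  [set xi | enorm xi = 1].
Arguments sphere : clear implicits.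

(* Meaningful for xi on the unit sphere only. *)
Definition proj_perp (R : realType) (n : nat) (xi x : 'rV[R]_n) : 'rV[R]_n :=
  x - dot x xi *: xi.

(* Matrices act on row vectors from the right. *)
Definition SO (R : realType) (n : nat) : set 'M[R]_n :=
  [set Phi | Phi *m Phi^T = 1%:M /\ \det Phi = 1].
Arguments SO : clear implicits.

(* Rotations of the hyperplane orthogonal to xi, encoded as the elements of
   SO(n) fixing xi: restriction to the hyperplane identifies the two groups. *)
Definition SO_perp (R : realType) (n : nat) (xi : 'rV[R]_n) : set 'M[R]_n :=
  [set Phi | SO R n Phi /\ xi *m Phi = xi].

Definition convex_body (R : realType) (n : nat) (K : set 'rV[R]_n) : Prop :=
  [/\ compact K, convex_set K & K° !=set0].

Definition polar (R : realType) (n : nat) (K : set 'rV[R]_n) : set 'rV[R]_n :=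
  [set x | forall y, K y -> dot x y <= 1].

Definition lebesgue_cons (R : realType) (n : nat)
    (mu : set (n.-tuple (measurableTypeR R)) -> \bar R) :
    set (n.+1.-tuple (measurableTypeR R)) -> \bar R :=
  pushforward (lebesgue_measure \x mu)%E (fun p => [tuple of p.1 :: p.2]).

(* Lebesgue measure on R^n, with the product sigma-algebra; as all measures of
   the library it is a total function, meaningful on measurable sets. *)
Fixpoint lebesgue_tuple (R : realType) (n : nat) :
    set (n.-tuple (measurableTypeR R)) -> \bar R :=
  match n with
  | 0 => \d_ [tuple]
  | m.+1 => lebesgue_cons (@lebesgue_tuple R m)
  end.

Section lebesgue_cons_measure.
Context (R : realType) (n : nat).
Local Notation T := (measurableTypeR R).
Variable mu : {sigma_finite_measure set (n.-tuple T) -> \bar R}.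
Local Open Scope ereal_scope.

Let consT (p : T * n.-tuple T) : n.+1.-tuple T := [tuple of p.1 :: p.2].

Let measurable_consT : measurable_fun setT consT.
Proof. exact: measurable_cons. Qed.

Local Notation step := (lebesgue_cons mu).

Let step0 : step set0 = 0.
Proof. by rewrite /lebesgue_cons /pushforward preimage_set0 measure0. Qed.

Let step_ge0 A : 0 <= step A.
Proof. exact: measure_ge0. Qed.

Let step_sigma_additive : semi_sigma_additive step.
Proof.
move=> F mF tF mUF; rewrite /lebesgue_cons /pushforward preimage_bigcup.
have mpre X : measurable X -> measurable (consT @^-1` X).
  by move=> mX; rewrite -[Y in measurable Y]setTI; exact: measurable_consT.
apply: measure_semi_sigma_additive => [k| |].
- exact: mpre.
- apply/trivIsetP => /= i j _ _ ij; rewrite -preimage_setI.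
  by move/trivIsetP : tF => /(_ _ _ _ _ ij) ->//; rewrite preimage_set0.
- by rewrite -preimage_bigcup; exact: mpre.
Qed.

HB.instance Definition _ :=
  isMeasure.Build _ _ _ step step0 step_ge0 step_sigma_additive.

Let step_sigma_finite : sigma_finite setT step.
Proof.
have /sigma_finiteP[F [TF ndF Foo]] := sigma_finiteT (@lebesgue_measure R).
have /sigma_finiteP[G [TG ndG Goo]] := sigma_finiteT mu.
pose uncons (t : n.+1.-tuple T) : (T * n.-tuple T)%type :=
  (thead t, [tuple of behead t]).
have consK : cancel consT uncons.
  by move=> [x t]; congr pair; exact/val_inj.
have muncons : measurable_fun setT uncons.
  apply/measurable_fun_pair; first exact: measurable_tnth.
  exact: measurable_behead.
exists (fun k => uncons @^-1` (F k `*` G k)).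
  apply/esym/seteqP; split=> // t _.
  have [i _ Fi] : (\bigcup_i F i) (thead t) by rewrite -TF.
  have [j _ Gj] : (\bigcup_j G j) [tuple of behead t] by rewrite -TG.
  exists (maxn i j) => //; split => /=.
  - by move: Fi; exact/subsetPset/ndF/leq_maxl.
  - by move: Gj; exact/subsetPset/ndG/leq_maxr.
move=> k; have [mF Fk] := Foo k; have [mG Gk] := Goo k; split.
  by rewrite -[X in measurable X]setTI; apply: muncons => //; exact: measurableX.
rewrite /lebesgue_cons /pushforward -comp_preimage.
rewrite (_ : uncons \o _ = id); last first.
  by apply/funext => p; exact: consK.
by rewrite preimage_id product_measure1E// lte_mul_pinfty// ge0_fin_numE.
Qed.

HB.instance Definition _ :=
  Measure_isSigmaFinite.Build _ _ _ step step_sigma_finite.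

End lebesgue_cons_measure.

Section lebesgue_tuple_measure.
Context (R : realType).
Local Notation T := (measurableTypeR R).
Local Open Scope ereal_scope.

Let lebesgue_tuple_exists n :
  {mu : {sigma_finite_measure set (n.-tuple T) -> \bar R} |
    mu = @lebesgue_tuple R n :> (_ -> _)}.
Proof.
elim: n => [|n [mu muE]]; first by exists (\d_ ([tuple] : 0.-tuple T)).
by exists (lebesgue_cons mu); rewrite /= -muE.
Qed.

Let lebesgue_tuple0 n : @lebesgue_tuple R n set0 = 0.
Proof. by case: (lebesgue_tuple_exists n) => mu <-; exact: measure0. Qed.

Let lebesgue_tuple_ge0 n A : 0 <= @lebesgue_tuple R n A.
Proof. by case: (lebesgue_tuple_exists n) => mu <-; exact: measure_ge0. Qed.

Let lebesgue_tuple_sigma_additive n :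
  semi_sigma_additive (@lebesgue_tuple R n).
Proof.
case: (lebesgue_tuple_exists n) => mu <-.
exact: measure_semi_sigma_additive.
Qed.

HB.instance Definition _ n := isMeasure.Build _ _ _ (@lebesgue_tuple R n)
  (lebesgue_tuple0 n) (@lebesgue_tuple_ge0 n)
  (@lebesgue_tuple_sigma_additive n).

Let lebesgue_tuple_sigma_finite n : sigma_finite setT (@lebesgue_tuple R n).
Proof.
by case: (lebesgue_tuple_exists n) => mu <-; exact: sigma_finiteT.
Qed.

HB.instance Definition _ n := Measure_isSigmaFinite.Build _ _ _
  (@lebesgue_tuple R n) (@lebesgue_tuple_sigma_finite n).

Lemma lebesgue_tuple_box n (A : 'I_n -> set T) : (forall i, measurable (A i)) ->
  lebesgue_tuple [set t : n.-tuple T | forall i, A i (tnth t i)] =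
  \prod_(i < n) lebesgue_measure (A i).
Proof.
elim: n A => [|n IH] A mA.
  by rewrite big_ord0 /= diracE mem_set// => -[].
pose B := [set t : n.-tuple T | forall i, A (lift ord0 i) (tnth t i)].
have mB : measurable B.
  rewrite (_ : B = \bigcap_(i in setT)
      ((fun t : n.-tuple T => tnth t i) @^-1` A (lift ord0 i))); last first.
    by apply/seteqP; split=> t /= Bt i => [_|]; exact: Bt.
  apply: fin_bigcap_measurable => // i _; rewrite -[X in measurable X]setTI.
  exact: measurable_tnth.
rewrite big_ord_recl -(IH (fun i => A (lift ord0 i)))// -/B.
rewrite /= /lebesgue_cons /pushforward -product_measure1E//; congr (_ _).
apply/seteqP; split => -[x t] /= xtA.
  split; first exact: (xtA ord0).
  by move=> i; have := xtA (lift ord0 i); rewrite tnthS.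
by move=> i; case: (unliftP ord0 i) => [j|] ->; [rewrite tnthS; apply: xtA.2|exact: xtA.1].
Qed.

End lebesgue_tuple_measure.

Definition vol (R : realType) (n : nat) (A : set 'rV[R]_n) : \bar R :=
  lebesgue_tuple [set t | A (\row_i tnth t i)].

(* Main.v *)
(* Duality turns projections into sections: writing K' and L' for the polar
   bodies, for every unit xi a rotation fixing xi maps the section of L' by the
   hyperplane orthogonal to xi into that of K'.  To stay with Lebesgue measure on
   R^n, sections are thickened to double cones |x.y| < sqrt d |x||y| around the
   hyperplane orthogonal to y: since K, L and L' are bounded, the rotation still
   maps the part of L' in a thin cone into (1 + e) K', uniformly in y.
   Integrating the resulting volume inequality over y in the unit ball and
   exchanging the integrals gives c vol L' <= c vol ((1 + e) K'), where c is the
   measure of the set of y whose cone contains a given x != 0, which by rotation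
   invariance does not depend on x.  Then let e tend to 0. *)
Require Import Defs.
From mathcomp Require Import all_boot all_order all_algebra.
From mathcomp Require Import all_classical all_reals all_analysis.
From mathcomp Require Import measurable_realfun ring lra.
Set Implicit Arguments.
Unset Strict Implicit.
Unset Printing Implicit Defensive.
Import Order.TTheory GRing.Theory Num.Theory.
Import numFieldNormedType.Exports.
Local Open Scope classical_set_scope.
Local Open Scope ring_scope.

(** * Lebesgue measure on R^n: translations and Fubini *)

(** The pushforward of Lebesgue measure under a translation gives every half-open interval its
    length, and this determines the measure. *)
Lemma lebesgue_measure_translate (R : realType) (a : R)
    (A : set (measurableTypeR R)) :
  measurable A -> lebesgue_measure [set x | A (x + a)] = lebesgue_measure A.
Proof.
move=> mA; apply/esym; pose T := measurableTypeR R.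
have mf : measurable_fun setT (fun x : T => (x + a : T)).
  by apply: measurable_funD => //; exact: measurable_cst.
pose mu := measure_function_pushforward__canonical__measure_function_Measure
  (@lebesgue_measure R) mf.
apply: (@lebesgue_measure_unique R mu) => // _ [[b c] _ <-].
rewrite /mu /= /pushforward.
rewrite (_ : _ @^-1` _ = `]b - a, c - a]%classic); last first.
  by apply/seteqP; split => x /=; rewrite !in_itv /= ltrBlDr lerBrDr.
rewrite !lebesgue_measure_itv /= !lte_fin ltrD2r -!EFinB.
by rewrite opprB addrA subrK.
Qed.

Section tuple_measure.
Context (R : realType) (n : nat).
Local Notation T := (measurableTypeR R).

Definition box (A : 'I_n -> set T) : set (n.-tuple T) :=
  [set t | forall i, A i (tnth t i)].

Lemma measurable_box (A : 'I_n -> set T) :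
  (forall i, measurable (A i)) -> measurable (box A).
Proof.
move=> mA.
rewrite (_ : box A = \bigcap_(i in setT) ((fun t => tnth t i) @^-1` A i)).
  apply: fin_bigcap_measurable => // i _; rewrite -[X in measurable X]setTI.
  exact: measurable_tnth.
by apply/seteqP; split=> t At i => [_|]; exact: At.
Qed.

Lemma lebesgue_box (A : 'I_n -> set T) : (forall i, measurable (A i)) ->
  lebesgue_tuple (box A) = (\prod_(i < n) lebesgue_measure (A i))%E.
Proof. exact: lebesgue_tuple_box. Qed.

(** Boxes are stable under intersection and generate the product sigma-algebra, and the cubes [g k]
    of finite measure exhaust the space. *)
Lemma lebesgue_tuple_unique (mu : {measure set (n.-tuple T) -> \bar R}) :
  (forall A : 'I_n -> set T, (forall i, measurable (A i)) ->
    mu (box A) = lebesgue_tuple (box A)) ->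
  forall A, measurable A -> mu A = lebesgue_tuple A.
Proof.
move=> muE A mA; apply/esym.
pose G := [set B | exists2 C : 'I_n -> set T,
  (forall i, measurable (C i)) & B = box C].
pose g (k : nat) : set (n.-tuple T) := box (fun=> `]- k%:R, k%:R]%classic).
apply: (@measure_unique _ _ _ G g) => //.
- apply/seteqP; split.
    apply: smallest_sub; first exact: smallest_sigma_algebra.
    rewrite -bigcup_seq => _ [i /= _ [Y mY <-]].
    apply: sub_sigma_algebra.
    (* A cylinder over the coordinate [i] is a box whose other sides are the whole line. *)
    exists (fun j => if j == i then Y else setT).
      by move=> j; case: ifP.
    apply/seteqP; split => [t [_ Yt] j|t /(_ i)] /=; first by case: eqP => // ->.
    by rewrite eqxx.
  apply: smallest_sub; first exact: sigma_algebra_measurable.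
  by move=> _ [C mC ->]; exact: measurable_box.
- move=> _ _ [C mC ->] [D mD ->]; exists (fun i => C i `&` D i).
    by move=> i; exact: measurableI.
  by apply/seteqP; split => [t [tC tD] i|t tCD]; split => // i; case: (tCD i).
- move=> k; eexists; last reflexivity.
  by move=> i; exact: measurable_itv.
- apply/seteqP; split=> // t _.
  pose M := \sum_i `|tnth t i|.
  exists (Num.truncn M).+1 => // i /=; rewrite in_itv /=.
  have : `|tnth t i| < (Num.truncn M).+1%:R.
    apply: le_lt_trans (truncnS_gt _).
    by rewrite /M (bigD1 i) //= lerDl sumr_ge0.
  by rewrite ltr_norml => /andP[-> /ltW ->].
- by move=> _ [C mC ->]; rewrite muE.
- move=> k.
  have gE : lebesgue_tuple (g k) =
      (\prod_(i < n) (if - k%:R < k%:R :> R then k%:R + k%:R else 0)%:E)%E.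
    rewrite lebesgue_box; last by move=> i; exact: measurable_itv.
    apply: eq_bigr => i _; rewrite lebesgue_measure_itv /= lte_fin -EFinB opprK.
    by case: ifP.
  by rewrite [X in (X < _)%E]gE prodEFin ltry.
Qed.

Definition row_of (t : n.-tuple T) : 'rV[R]_n := \row_i tnth t i.
Definition tuple_of (x : 'rV[R]_n) : n.-tuple T := [tuple x 0 i | i < n].

Lemma tuple_ofK : cancel tuple_of row_of.
Proof. by move=> x; apply/rowP => i; rewrite mxE tnth_mktuple. Qed.

(** Topology and matrices act on row vectors, the product sigma-algebra lives on tuples; the
    preimage is the very set that [vol] measures. *)
Definition rv_measurable (A : set 'rV[R]_n) := measurable (row_of @^-1` A).

Lemma measurable_tuple_of d (S : measurableType d) (f : S -> 'rV[R]_n) :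
  (forall i, measurable_fun setT (fun s => f s 0 i : T)) ->
  measurable_fun setT (tuple_of \o f).
Proof.
move=> mf; apply/measurable_fun_tnthP => i.
rewrite (_ : _ \o _ = fun s => f s 0 i)//.
by apply/funext => s /=; rewrite tnth_mktuple.
Qed.

Lemma measurable_preimage_rv d (S : measurableType d) (f : S -> 'rV[R]_n) A :
  rv_measurable A -> (forall i, measurable_fun setT (fun s => f s 0 i : T)) ->
  measurable (f @^-1` A).
Proof.
move=> mA /measurable_tuple_of mf.
rewrite (_ : f @^-1` A = setT `&` (tuple_of \o f) @^-1` (row_of @^-1` A)).
  exact: mf.
by rewrite setTI; apply/seteqP; split => s /=; rewrite tuple_ofK.
Qed.

Lemma vol_translate (A : set 'rV[R]_n) (a : 'rV[R]_n) :
  rv_measurable A -> vol [set x | A (x + a)] = vol A.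
Proof.
move=> mA; rewrite /vol.
have mf : measurable_fun setT (fun t => tuple_of (row_of t + a)).
  apply: measurable_tuple_of => i.
  under eq_fun do rewrite !mxE.
  by apply: measurable_funD; [exact: measurable_tnth|exact: measurable_cst].
pose mu := measure_function_pushforward__canonical__measure_function_Measure
  (@lebesgue_tuple R n) mf.
have <- : mu (row_of @^-1` A) = lebesgue_tuple (row_of @^-1` A).
  apply: lebesgue_tuple_unique => // B mB.
  rewrite /mu /= /pushforward.
  rewrite (_ : _ @^-1` _ = box (fun i => [set x | B i (x + a 0 i)])); last first.
    apply/seteqP; split => t tB i; have := tB i;
    by rewrite /= !tnth_mktuple !mxE.
  rewrite [RHS]lebesgue_box // [LHS]lebesgue_box.
    by apply: eq_bigr => i _; exact: lebesgue_measure_translate.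
  move=> i.
  have mfi : measurable_fun setT (fun x : T => (x + a 0 i : T)).
    by apply: measurable_funD => //; exact: measurable_cst.
  by rewrite -[X in measurable X]setTI; exact: mfi.
rewrite /mu /= /pushforward; congr lebesgue_tuple.
by apply/seteqP; split => t /=; rewrite tuple_ofK.
Qed.

Definition rv2_measurable (W : 'rV[R]_n -> 'rV[R]_n -> Prop) :=
  measurable [set p : n.-tuple T * n.-tuple T | W (row_of p.1) (row_of p.2)].

(** Tonelli for the indicator of [W]: the slice volumes are its inner integrals. *)
Lemma vol_fubini (W : 'rV[R]_n -> 'rV[R]_n -> Prop) : rv2_measurable W ->
  (\int[@lebesgue_tuple R n]_t vol [set y | W (row_of t) y] =
   \int[@lebesgue_tuple R n]_t vol [set x | W x (row_of t)])%E.
Proof.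
move=> mW; have := indic_fubini_tonelli (@lebesgue_tuple R n) (@lebesgue_tuple R n) mW.
rewrite indic_fubini_tonelli_FE// indic_fubini_tonelli_GE//.
congr (_ = _); apply: eq_integral => t _ /=; congr lebesgue_tuple.
  by apply/seteqP; split => s; rewrite /xsection /= inE.
by apply/seteqP; split => s; rewrite /ysection /= inE.
Qed.

End tuple_measure.

(** * Inner product and measurable sets *)

Section dot_theory.
Context (R : realType) (n : nat).
Implicit Types x y z : 'rV[R]_n.

Lemma dotE x y : dot x y = \sum_i x 0 i * y 0 i.
Proof. by rewrite /dot mxE; apply: eq_bigr => i _; rewrite mxE. Qed.

Lemma dotC x y : dot x y = dot y x.
Proof. by rewrite !dotE; apply: eq_bigr => i _; rewrite mulrC. Qed.

Lemma dotDl x y z : dot (x + y) z = dot x z + dot y z.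
Proof. by rewrite /dot mulmxDl mxE. Qed.

Lemma dotZl a x y : dot (a *: x) y = a * dot x y.
Proof. by rewrite /dot -scalemxAl mxE. Qed.

Lemma dotNl x y : dot (- x) y = - dot x y.
Proof. by rewrite -scaleN1r dotZl mulN1r. Qed.

Lemma dotBl x y z : dot (x - y) z = dot x z - dot y z.
Proof. by rewrite dotDl dotNl. Qed.

Lemma dotDr x y z : dot x (y + z) = dot x y + dot x z.
Proof. by rewrite dotC dotDl !(dotC _ x). Qed.

Lemma dotZr a x y : dot x (a *: y) = a * dot x y.
Proof. by rewrite dotC dotZl dotC. Qed.

Lemma dotNr x y : dot x (- y) = - dot x y.
Proof. by rewrite dotC dotNl dotC. Qed.

Lemma dotBr x y z : dot x (y - z) = dot x y - dot x z.
Proof. by rewrite dotDr dotNr. Qed.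

Lemma dot0l x : dot 0 x = 0.
Proof. by rewrite -(scale0r 0) dotZl mul0r. Qed.

Lemma dot_mulmxl (M : 'M[R]_n) x y : dot (x *m M) y = dot x (y *m M^T).
Proof. by rewrite /dot trmx_mul trmxK mulmxA. Qed.

Lemma dot_orthogonal (M : 'M[R]_n) x y :
  M *m M^T = 1%:M -> dot (x *m M) (y *m M) = dot x y.
Proof. by move=> MM; rewrite dot_mulmxl -mulmxA MM mulmx1. Qed.

Lemma dot_ge0 x : 0 <= dot x x.
Proof. by rewrite dotE sumr_ge0// => i _; rewrite -expr2 sqr_ge0. Qed.

Lemma dot_eq0 x : (dot x x == 0) = (x == 0).
Proof.
apply/idP/eqP => [|->]; last by rewrite dot0l.
rewrite dotE psumr_eq0 => [/allP x0|i _]; last by rewrite -expr2 sqr_ge0.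
apply/rowP => i; rewrite mxE; apply/eqP.
by have := x0 i (mem_index_enum _); rewrite mulf_eq0 orbb.
Qed.

Lemma dot_gt0 x : (0 < dot x x) = (x != 0).
Proof. by rewrite lt0r dot_ge0 andbT dot_eq0. Qed.

Lemma sqr_coord_le_dot x i : x 0 i ^+ 2 <= dot x x.
Proof.
rewrite dotE (bigD1 i)//= -expr2 lerDl sumr_ge0// => j _.
by rewrite -expr2 sqr_ge0.
Qed.

Lemma normr_coord_le1 x i : dot x x < 1 -> `|x 0 i| <= 1.
Proof.
move=> /ltW x1; rewrite -(@ler_pXn2r _ 2)// ?nnegrE// expr1n real_normK ?num_real//.
exact: le_trans (sqr_coord_le_dot _ _) x1.
Qed.

Lemma cauchy_schwarz x y : dot x y ^+ 2 <= dot x x * dot y y.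
Proof.
have [->|x0] := eqVneq x 0; first by rewrite !dot0l expr0n mul0r.
have xx : 0 < dot x x by rewrite dot_gt0.
(* This vector is [dot x x] times the component of [y] orthogonal to [x]. *)
have := dot_ge0 (dot x x *: y - dot x y *: x).
rewrite !(dotBl, dotBr, dotZl, dotZr) (dotC y x).
rewrite (_ : _ - _ = dot x x * (dot x x * dot y y - dot x y ^+ 2)); last by ring.
by rewrite pmulr_rge0// subr_ge0.
Qed.

Lemma continuous_dot (S : topologicalType) (f g : S -> 'rV[R]_n) :
  continuous f -> continuous g -> continuous (fun s => dot (f s) (g s)).
Proof.
move=> cf cg; under eq_fun do rewrite dotE.
apply: continuous_big => [|i _ x]; first exact: add_continuous.
by apply: cvgM; apply: (continuous_comp _ (@coord_continuous _ _ _ _ _ _));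
  [exact: cf|exact: cg].
Qed.

End dot_theory.

Lemma open_ltr (R : realType) (S : topologicalType) (f g : S -> R) :
  continuous f -> continuous g -> open [set s | f s < g s].
Proof.
move=> cf cg.
rewrite (_ : [set _ | _] = (fun s => g s - f s) @^-1` [set x | 0 < x]).
  by apply: open_comp; [move=> s _; apply: cvgB; [exact: cg|exact: cf]|exact: open_gt].
by apply/seteqP; split => s /=; rewrite subr_gt0.
Qed.


Section measurable_sets.
Context (R : realType) (n : nat).
Local Notation T := (measurableTypeR R).

Lemma measurable_ltr_set d (S : measurableType d) (f g : S -> T) :
  measurable_fun setT f -> measurable_fun setT g ->
  measurable [set s | (f s : R) < g s].
Proof.
move=> mf mg.
rewrite (_ : [set _ | _] = setT `&` (fun s => (f s : R) < g s) @^-1` [set true]).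
  exact: measurable_fun_ltr.
by rewrite setTI; apply/seteqP; split.
Qed.

Lemma measurable_dot d (S : measurableType d) (f g : S -> 'rV[R]_n) :
  (forall i, measurable_fun setT (fun s => f s 0 i : T)) ->
  (forall i, measurable_fun setT (fun s => g s 0 i : T)) ->
  measurable_fun setT (fun s => dot (f s) (g s) : T).
Proof.
move=> mf mg; under eq_fun do rewrite dotE.
by apply: measurable_sum => i; apply: measurable_funM; [exact: mf|exact: mg].
Qed.

Lemma measurable_coord i : measurable_fun setT (fun t : n.-tuple T => row_of t 0 i : T).
Proof.
under eq_fun do rewrite mxE.
exact: measurable_tnth.
Qed.

Lemma measurable_coord_fst i :
  measurable_fun setT (fun p : n.-tuple T * n.-tuple T => row_of p.1 0 i : T).
Proof. exact: (measurableT_comp (measurable_coord i)). Qed.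

Lemma measurable_coord_snd i :
  measurable_fun setT (fun p : n.-tuple T * n.-tuple T => row_of p.2 0 i : T).
Proof. exact: (measurableT_comp (measurable_coord i)). Qed.

Lemma measurable_mulmx_coord d (S : measurableType d) (f : S -> 'rV[R]_n)
    (M : 'M[R]_n) :
  (forall i, measurable_fun setT (fun s => f s 0 i : T)) ->
  forall i, measurable_fun setT (fun s => (f s *m M) 0 i : T).
Proof.
move=> mf i; under eq_fun do rewrite mxE.
apply: measurable_sum => j; apply: measurable_funM; first exact: mf.
exact: measurable_cst.
Qed.

Lemma rv_measurableC (A : set 'rV[R]_n) : rv_measurable A -> rv_measurable (~` A).
Proof. by move=> mA; rewrite /rv_measurable preimage_setC; exact: measurableC. Qed.

Lemma rv_measurableI (A B : set 'rV[R]_n) :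
  rv_measurable A -> rv_measurable B -> rv_measurable (A `&` B).
Proof. by move=> mA mB; rewrite /rv_measurable preimage_setI; exact: measurableI. Qed.

Lemma nbhs_rv (x : 'rV[R]_n) (U : set 'rV[R]_n) : nbhs x U ->
  exists2 e : R, 0 < e & forall y : 'rV[R]_n, (forall i, `|x 0 i - y 0 i| < e) -> U y.
Proof.
move=> /nbhs_ballP[e /= e0 eU]; exists e => // y xy; apply: eU; split => // i j.
rewrite (ord1 i); exact: xy.
Qed.

Lemma open_rv_measurable (U : set 'rV[R]_n) : open U -> rv_measurable U.
Proof.
move=> oU.
(* An open set is the union of the countably many cubes with rational centre and half-side
   [1 / (m + 1)] that it contains; [C] enumerates them through [pickle_inv]. *)
pose B (q : 'rV[rat]_n * nat) : set (n.-tuple T) :=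
  box (fun i => [set` `]ratr (q.1 0 i) - q.2.+1%:R^-1, ratr (q.1 0 i) + q.2.+1%:R^-1[]).
pose C k := if @pickle_inv ('rV[rat]_n * nat)%type k is Some q then
    if `[< B q `<=` row_of (n := n) @^-1` U >] then B q else set0
  else set0.
have mC k : measurable (C k).
  rewrite /C; case: pickle_inv => // q; case: ifP => // _.
  by apply: measurable_box => i; exact: measurable_itv.
rewrite /rv_measurable (_ : _ @^-1` _ = \bigcup_k C k); first exact: bigcupT_measurable.
apply/seteqP; split => [t Ut|t [k _]]; last first.
  by rewrite /C; case: pickle_inv => // q; case: asboolP => // BU /BU.
have [e e0 eU] := nbhs_rv (oU _ Ut).
(* The centre is chosen within [1 / (k + 1)] of [t], so the points of the cube are within
   [2 / (k + 1) < e] of [t]. *)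
pose k := (Num.truncn (2 / e)).
have ke : k.+1%:R^-1 * 2 < e.
  have : 2 / e < k.+1%:R by exact: truncnS_gt.
  by rewrite ltr_pdivrMr// mulrC => h; rewrite mulrC ltr_pdivrMr.
have k0 : 0 < k.+1%:R^-1 :> R by rewrite invr_gt0.
have qP i : {q : rat | `|row_of t 0 i - ratr q| < k.+1%:R^-1}.
  apply: cid; move: (row_of t 0 i) => x.
  have : x - k.+1%:R^-1 < x + k.+1%:R^-1 by rewrite ltrBlDr -addrA ltrDl addr_gt0.
  move=> /rat_in_itvoo[q]; rewrite in_itv /= => /andP[h1 h2].
  by exists q; rewrite distrC ltr_distl h1.
pose q : 'rV[rat]_n := \row_i sval (qP i).
have qE i : q 0 i = sval (qP i) by rewrite mxE.
exists (pickle (q, k)) => //; rewrite /C pickleK_inv.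
case: asboolP => [_ i|[]].
  by have := svalP (qP i); rewrite -qE mxE /= in_itv /= ltr_distl.
move=> s sB; apply: eU => i; apply: lt_trans ke.
have := sB i; rewrite /= in_itv /= qE -ltr_distl => h.
rewrite mulr2n mulrDr mulr1 (le_lt_trans (ler_distD (ratr (sval (qP i))) _ _))//.
by rewrite ltrD ?(svalP (qP i))// distrC mxE.
Qed.

Lemma closed_rv_measurable (A : set 'rV[R]_n) : closed A -> rv_measurable A.
Proof.
move=> cA; rewrite -(setCK A); apply: rv_measurableC.
by apply: open_rv_measurable; rewrite openC.
Qed.

Lemma rv_measurable_dot_lt1 : rv_measurable [set x : 'rV[R]_n | dot x x < 1].
Proof.
apply: measurable_ltr_set; last exact: measurable_cst.
by apply: measurable_dot => i; exact: measurable_coord.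
Qed.

Lemma rv_measurable_set0 : rv_measurable [set 0 : 'rV[R]_n].
Proof.
rewrite (_ : [set _] = ~` [set x | 0 < dot x x]).
  apply: rv_measurableC; apply: measurable_ltr_set; first exact: measurable_cst.
  by apply: measurable_dot => i; exact: measurable_coord.
apply/seteqP; split => x /=; rewrite dot_gt0.
  by move=> ->; rewrite eqxx.
by move=> /negP; rewrite negbK => /eqP.
Qed.

Lemma rv_measurableD0 (A : set 'rV[R]_n) :
  rv_measurable A -> rv_measurable (A `\ (0 : 'rV[R]_n)).
Proof.
move=> mA; rewrite setDE; apply: rv_measurableI => //.
exact: (rv_measurableC rv_measurable_set0).
Qed.

Lemma le_vol (A B : set 'rV[R]_n) : rv_measurable A -> rv_measurable B ->
  A `<=` B -> (vol A <= vol B)%E.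
Proof.
by move=> mA mB AB; apply: le_measure; rewrite ?inE// => t; exact: AB.
Qed.

Lemma vol_gt0 (U : set 'rV[R]_n) (x : 'rV[R]_n) :
  rv_measurable U -> nbhs x U -> (0 < vol U)%E.
Proof.
move=> mU /nbhs_rv[e e0 eU].
pose B : 'I_n -> set T := fun i => [set` `]x 0 i - e, x 0 i + e[].
have mB i : measurable (B i) by exact: measurable_itv.
apply: (@lt_le_trans _ _ (lebesgue_tuple (box B))).
  rewrite lebesgue_box// (eq_bigr (fun=> (e + e)%:E)); last first.
    move=> i _; rewrite lebesgue_measure_itv /= lte_fin.
    rewrite ifT; last by lra.
    by rewrite -EFinB; congr EFin; ring.
  by rewrite prodEFin lte_fin prodr_gt0// => i _; lra.
apply: le_measure; rewrite ?inE//; first exact: measurable_box.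
move=> t tB; apply: eU => i; rewrite mxE; have := tB i; rewrite /B /= in_itv /=.
by move=> /andP[h1 h2]; rewrite ltr_norml; apply/andP; split; lra.
Qed.

Lemma vol_lty (A : set 'rV[R]_n) M : rv_measurable A ->
  (forall x, A x -> forall i, `|x 0 i| <= M) -> (vol A < +oo)%E.
Proof.
move=> mA AM.
pose B : 'I_n -> set T := fun i => [set` `[- M, M]].
have mB i : measurable (B i) by exact: measurable_itv.
apply: (@le_lt_trans _ _ (lebesgue_tuple (box B))).
  apply: le_measure; rewrite ?inE//; first exact: measurable_box.
  by move=> t /AM tB i; rewrite /B /= in_itv /= -ler_norml; have := tB i; rewrite mxE.
(* A side has length 0 if [M] is not positive; both values are finite. *)
rewrite lebesgue_box// (eq_bigr (fun=> (if - M < M then M + M else 0)%:E)).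
  by rewrite prodEFin ltry.
move=> i _; rewrite lebesgue_measure_itv /= lte_fin.
by case: ifP => //; rewrite -EFinB opprK.
Qed.

End measurable_sets.

(** * Orthogonal invariance *)

Section invariance.
Context (R : realType) (n : nat).
Local Notation T := (measurableTypeR R).

(** Evaluates a side of the Fubini identity when the slices over [D] all have volume [c] and the
    others are empty. *)
Lemma integral_rv_const (D : set 'rV[R]_n) (f : 'rV[R]_n -> \bar R) c :
  rv_measurable D -> (forall x, D x -> f x = c) ->
  (forall x, ~ D x -> f x = 0%E) ->
  (\int[@lebesgue_tuple R n]_t f (row_of t) = c * vol D)%E.
Proof.
move=> mD fD fC; rewrite /vol -(integral_cst _ mD) integral_mkcond.
apply: eq_integral => t _; rewrite patchE.
case: ifPn; first by rewrite inE => /fD.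
by rewrite notin_setE => /fC.
Qed.

Lemma vol0 : vol (set0 : set 'rV[R]_n) = 0%E.
Proof. exact: (measure0 (@lebesgue_tuple R n)). Qed.

Lemma rv2_measurable_l (W : 'rV[R]_n -> 'rV[R]_n -> Prop) y :
  rv2_measurable W -> rv_measurable [set x | W x y].
Proof.
move=> mW.
have mf : measurable_fun setT (fun t : n.-tuple T => (t, tuple_of y)).
  by apply/measurable_fun_pair => //; exact: measurable_cst.
rewrite /rv_measurable (_ : _ @^-1` _ = setT `&`
  (fun t : n.-tuple T => (t, tuple_of y)) @^-1` [set p | W (row_of p.1) (row_of p.2)]).
  exact: mf.
by rewrite setTI; apply/seteqP; split => t /=; rewrite tuple_ofK.
Qed.

Lemma rv2_measurable_r (W : 'rV[R]_n -> 'rV[R]_n -> Prop) x :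
  rv2_measurable W -> rv_measurable [set y | W x y].
Proof.
move=> mW.
have mf : measurable_fun setT (fun t : n.-tuple T => (tuple_of x, t)).
  by apply/measurable_fun_pair => //; exact: measurable_cst.
rewrite /rv_measurable (_ : _ @^-1` _ = setT `&`
  (fun t : n.-tuple T => (tuple_of x, t)) @^-1` [set p | W (row_of p.1) (row_of p.2)]).
  exact: mf.
by rewrite setTI; apply/seteqP; split => t /=; rewrite tuple_ofK.
Qed.

(* Fubini argument behind the uniqueness of Haar measure: by translation
   invariance, the measure of the pairs (x, y) with x M in A and y - x M in B is
   vol B * vol (A M^-1) when sliced along x, and vol A * vol B when sliced along
   y and then, after substituting x + y M^-1 for x, along x again.  Applied to
   the unit ball B, which M preserves. *)
Lemma vol_orthogonal (M : 'M[R]_n) (A : set 'rV[R]_n) :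
  M *m M^T = 1%:M -> rv_measurable A -> vol [set x | A (x *m M)] = vol A.
Proof.
move=> MM mA; have MM' := mulmx1C MM.
pose B := [set x : 'rV[R]_n | dot x x < 1].
have mB : rv_measurable B := @rv_measurable_dot_lt1 R n.
have mAM : rv_measurable [set x | A (x *m M)].
  apply: (measurable_preimage_rv (f := fun t => row_of t *m M)) mA _.
  by apply: measurable_mulmx_coord => i; exact: measurable_coord.
have BN x : B (- x) = B x by rewrite /B /= dotNl dotNr opprK.
have mfstM := measurable_mulmx_coord M (@measurable_coord_fst R n).
pose W1 x y := A (x *m M) /\ B (y - x *m M).
pose W2 x y := A (x *m M + y) /\ B (- (x *m M)).
have mW1 : rv2_measurable W1.
  apply: measurableI; first exact: (measurable_preimage_rv mA mfstM).
  apply: (measurable_preimage_rv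
    (f := fun p => row_of p.2 - row_of p.1 *m M)) mB _ => i.
  under eq_fun do rewrite mxE [X in _ + X]mxE.
  by apply: measurable_funB; [exact: measurable_coord_snd|exact: mfstM].
have mW2 : rv2_measurable W2.
  apply: measurableI.
    apply: (measurable_preimage_rv
      (f := fun p => row_of p.1 *m M + row_of p.2)) mA _ => i.
    under eq_fun do rewrite mxE.
    by apply: measurable_funD; [exact: mfstM|exact: measurable_coord_snd].
  apply: (measurable_preimage_rv (f := fun p => - (row_of p.1 *m M))) mB _ => i.
  under eq_fun do rewrite mxE.
  by apply: measurable_funN; exact: mfstM.
have BA : (vol B * vol [set x | A (x *m M)] = vol A * vol B)%E.
  rewrite -(integral_rv_const (f := fun x => vol [set y | W1 x y]) mAM).
  - rewrite (vol_fubini mW1).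
    rewrite -(integral_rv_const (f := fun x => vol [set y | W2 x y]) mB).
    + rewrite (vol_fubini mW2); apply: eq_integral => t _.
      rewrite -(vol_translate (row_of t *m M^T) (rv2_measurable_l _ mW1)).
      congr vol; apply/seteqP; rewrite /W1 /W2; split => x /=;
        by rewrite mulmxDl -mulmxA MM' mulmx1 opprD addrCA subrr addr0.
    + move=> x Bx; rewrite -[RHS](vol_translate (x *m M) mA); congr vol.
      apply/seteqP; rewrite /W2; split => y /=; rewrite addrC; first by case.
      by split=> //; rewrite BN /B /= dot_orthogonal.
    + move=> x Bx; rewrite -[RHS]vol0; congr vol.
      apply/seteqP; split => y //= [_]; rewrite BN /B /= dot_orthogonal//; move/Bx.
  - move=> x Ax; rewrite -[RHS](vol_translate (- (x *m M)) mB); congr vol.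
    by apply/seteqP; split => y //= [].
  - move=> x Ax; rewrite -[RHS]vol0; congr vol.
    by apply/seteqP; split => y //= [].
(* Being positive and finite, [vol B] can be cancelled from [BA]. *)
have B0 : (0 < vol B)%E.
  apply: (vol_gt0 (x := 0) mB); apply: open_nbhs_nbhs; split; last first.
    by rewrite /B /= dot0l.
  by apply: open_ltr; [apply: continuous_dot => s; exact: cvg_id|exact: cst_continuous].
have Boo : (vol B < +oo)%E.
  apply: (vol_lty (M := 1)) mB _ => x B1 i; exact: normr_coord_le1.
have Bfin : vol B \is a fin_num by rewrite ge0_fin_numE// ltW.
by apply/le_anti/andP; split; rewrite -(lee_pmul2l Bfin B0) BA muleC lexx.
Qed.
End invariance.

(** * Averaging over thin cones *)

Section cones.
Context (R : realType) (n : nat).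
Local Notation T := (measurableTypeR R).

Lemma orthogonal_transitive (x y : 'rV[R]_n) : dot x x = dot y y ->
  exists2 M : 'M[R]_n, M *m M^T = 1%:M & x *m M = y.
Proof.
(* M is the reflection in the hyperplane orthogonal to x - y. *)
move=> xy; have [w wE] : exists w, w = x - y by exists (x - y).
have [w0|w0] := eqVneq w 0.
  exists 1%:M; first by rewrite trmx1 mulmx1.
  by apply/eqP; rewrite mulmx1 -subr_eq0 -wE w0.
have ww : dot w w != 0 by rewrite dot_eq0.
have mulw (z : 'rV[R]_n) : z *m (w^T *m w) = dot z w *: w.
  by rewrite mulmxA [z *m w^T]mx11_scalar mul_scalar_mx.
pose M := 1%:M - (2 / dot w w) *: (w^T *m w).
have MT : M^T = M.
  by rewrite /M linearB /= trmx1 linearZ /= trmx_mul trmxK.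
exists M.
  rewrite MT /M mulmxBl mul1mx mulmxBr mulmx1 -scalemxAl -scalemxAr -mulmxA.
  rewrite [w *m (_ *m _)]mulw -scalemxAr !scalerA.
  rewrite (_ : 2 / dot w w * (_ * _) = 2 / dot w w + 2 / dot w w); last by field.
  rewrite scalerDl; move: (_ *: _) => a.
  by rewrite (_ : a - (a + a) = - a) ?opprK ?subrK// opprD addrA subrr sub0r.
rewrite /M mulmxBr mulmx1 -scalemxAr mulw scalerA.
(* Since [x] and [y] have the same norm, [dot w w = 2 * dot x w], so the reflection subtracts
   exactly [w] from [x]. *)
have -> : 2 / dot w w * dot x w = 1.
  apply: (mulIf ww); rewrite mul1r mulrAC divfK//.
  by rewrite wE !dotBl !dotBr -xy (dotC y x); ring.
by rewrite scale1r wE opprB addrC subrK.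
Qed.

(* The second condition bounds the cosine of the angle between x and y by sqrt d;
   being strict, it excludes x = 0 and y = 0. *)
Definition cone (d : R) (x y : 'rV[R]_n) :=
  dot y y < 1 /\ dot x y ^+ 2 < d * (dot x x * dot y y).

Lemma cone_orthogonal d x y (M : 'M[R]_n) : M *m M^T = 1%:M ->
  cone d (x *m M) (y *m M) = cone d x y.
Proof. by move=> MM; rewrite /cone !dot_orthogonal. Qed.

Lemma coneZ d a x y : a != 0 -> cone d (a *: x) y = cone d x y.
Proof.
move=> a0; rewrite /cone !dotZl !dotZr exprMn.
rewrite (_ : d * _ = a ^+ 2 * (d * (dot x x * dot y y))); last by ring.
by rewrite ltr_pM2l// exprn_even_gt0.
Qed.

Lemma cone_neq0 d x y : cone d x y -> x != 0 /\ y != 0.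
Proof.
move=> [_]; rewrite -!dot_eq0 => h; split; apply/eqP => h0; move: h.
  by rewrite h0 mul0r mulr0 ltNge sqr_ge0.
by rewrite h0 !mulr0 ltNge sqr_ge0.
Qed.

Lemma rv2_measurable_cone d : rv2_measurable (cone d).
Proof.
have mfst := @measurable_coord_fst R n; have msnd := @measurable_coord_snd R n.
apply: measurableI.
  apply: measurable_ltr_set; last exact: measurable_cst.
  by apply: measurable_dot.
apply: measurable_ltr_set.
  by apply: measurable_funX; exact: measurable_dot.
apply: measurable_funM; first exact: measurable_cst.
by apply: measurable_funM; exact: measurable_dot.
Qed.

Lemma rv_measurable_cone d x : rv_measurable [set y | cone d x y].
Proof. exact: (rv2_measurable_r x (rv2_measurable_cone d)). Qed.

(** Rescaling [x] does not change its cone, and once [x] is as long as [y] an orthogonal matrix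
    carries one to the other, preserving volume. *)
Lemma vol_cone_const d (x y : 'rV[R]_n) : x != 0 -> y != 0 ->
  vol [set z | cone d x z] = vol [set z | cone d y z].
Proof.
rewrite -!dot_gt0 => x0 y0.
pose a := Num.sqrt (dot y y / dot x x).
have a0 : a != 0 by rewrite gt_eqF// sqrtr_gt0 divr_gt0.
have [|M MM xMy] := @orthogonal_transitive (a *: x) y.
  rewrite dotZl dotZr mulrA -expr2 sqr_sqrtr ?divfK ?gt_eqF//.
  by rewrite divr_ge0// ltW.
rewrite -xMy -[RHS](vol_orthogonal MM); last exact: rv_measurable_cone.
by congr vol; apply/seteqP; split => z /=; rewrite cone_orthogonal// coneZ.
Qed.

Lemma vol_cone_lty d (x : 'rV[R]_n) : (vol [set y | cone d x y] < +oo)%E.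
Proof.
apply: (vol_lty (M := 1)); first exact: rv_measurable_cone.
by move=> y [y1 _] i; exact: normr_coord_le1.
Qed.

Lemma vol_cone_gt0 d (x : 'rV[R]_n) : (2 <= n)%N -> 0 < d -> x != 0 ->
  (0 < vol [set y | cone d x y])%E.
Proof.
move=> n2 d0 x0.
(* In dimension at least 2 there is a [v] orthogonal to [u], here of norm 1/2. Both strict
   inequalities defining the cone hold at [v], hence on a neighbourhood of it. *)
pose u : 'rV[R]_n := delta_mx 0 (Ordinal (ltnW n2)).
pose v : 'rV[R]_n := 2^-1 *: delta_mx 0 (Ordinal n2).
have dd (i j : 'I_n) : dot (delta_mx 0 i : 'rV[R]_n) (delta_mx 0 j) = (i == j)%:R.
  rewrite dotE (bigD1 i)//= big1 ?addr0 => [|k ki]; first by rewrite !mxE !eqxx mul1r.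
  by rewrite !mxE (negbTE ki) andbF mul0r.
have u0 : u != 0 by rewrite -dot_gt0 dd eqxx.
rewrite (vol_cone_const d x0 u0).
apply: (vol_gt0 (x := v)); first exact: rv_measurable_cone.
have continuous_id (S : topologicalType) : continuous (fun s : S => s).
  by move=> s; exact: cvg_id.
apply: open_nbhs_nbhs; split; last first.
  rewrite /= /cone /v /u !(dotZl, dotZr) !dd !eqxx /=; split; first by lra.
  by rewrite !mulr0 expr0n !mulr_gt0// ltr01.
apply: openI; apply: open_ltr.
- exact: continuous_dot.
- exact: cst_continuous.
- move=> y; apply: (continuous_comp (g := fun r : R => r ^+ 2)).
    by apply: continuous_dot => //; exact: cst_continuous.
  exact: exprn_continuous.
- under eq_fun do rewrite mulrA -dotZl.
  by apply: continuous_dot => // y; exact: scaler_continuous.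
Qed.

Lemma measurable_vol_section (W : 'rV[R]_n -> 'rV[R]_n -> Prop) : rv2_measurable W ->
  measurable_fun setT (fun t : n.-tuple T => vol [set x | W x (row_of t)]).
Proof.
move=> mW.
have := measurable_fun_ysection (@lebesgue_tuple R n) mW.
apply: eq_measurable_fun => t _ /=; congr lebesgue_tuple.
by apply/seteqP; split => s; rewrite /ysection /= inE.
Qed.

(** For [y != 0], the matrix [M] attached to the direction of [y] preserves the double cone given by
    [y] and sends the part of [A] inside it into [B]. Integrating over [y] and exchanging integrals
    leaves the same factor [c] on both sides. The origin is removed because no cone contains it. *)
Lemma vol_le_of_slices d (A B : set 'rV[R]_n) : (2 <= n)%N -> 0 < d ->
  rv_measurable A -> rv_measurable B ->
  (forall xi, dot xi xi = 1 -> exists M : 'M[R]_n,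
    [/\ M *m M^T = 1%:M, xi *m M = xi &
      forall x, A x -> dot x xi ^+ 2 < d * dot x x -> B (x *m M)]) ->
  (vol (A `\ 0%R) <= vol (B `\ 0%R))%E.
Proof.
move=> n2 d0 mA mB AB.
pose W (C : set 'rV[R]_n) x y := C x /\ cone d x y.
have mW (C : set 'rV[R]_n) : rv_measurable C -> rv2_measurable (W C).
  move=> mC; apply: measurableI; last exact: rv2_measurable_cone.
  apply: (measurable_preimage_rv
    (f := fun p : n.-tuple T * n.-tuple T => row_of p.1)) mC _ => i.
  exact: measurable_coord_fst.
pose e : 'rV[R]_n := delta_mx 0 (Ordinal n2).
have e0 : e != 0.
  by apply/eqP => /rowP/(_ (Ordinal n2)); rewrite !mxE !eqxx => /eqP; rewrite oner_eq0.
pose c := vol [set y | cone d e y].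
have c0 : (0 < c)%E by exact: vol_cone_gt0.
have cfin : c \is a fin_num by rewrite ge0_fin_numE ?vol_cone_lty// ltW.
(* Sliced at a nonzero [x] in [C], the relation [W C] leaves a set of volume [c]; any other slice is
   empty. *)
have cE (C : set 'rV[R]_n) : rv_measurable C -> (c * vol (C `\ 0%R) =
    \int[@lebesgue_tuple R n]_t vol [set x | W C x (row_of t)])%E.
  move=> mC; rewrite -(vol_fubini (mW _ mC)).
  rewrite -(integral_rv_const
    (f := fun x => vol [set y | W C x y]) (rv_measurableD0 mC))//.
    move=> x [Cx /eqP x0]; rewrite /c (vol_cone_const d e0 x0); congr vol.
    by apply/seteqP; split => y //= [].
  move=> x CDx; rewrite -[RHS](@vol0 R n); congr vol.
  apply/seteqP; split => y //= [Cx /cone_neq0[/eqP x0 _]]; exact: CDx.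
rewrite -(lee_pmul2l cfin c0) !cE//; apply: ge0_le_integral => //.
- exact: (measurable_vol_section (mW _ mA)).
- exact: (measurable_vol_section (mW _ mB)).
move=> t _; move: (row_of t) => y {t}.
have [y0|y0] := eqVneq y 0.
  rewrite (_ : [set x | _] = set0) ?vol0//.
  by apply/seteqP; split => x //= [_ /cone_neq0[_]]; rewrite y0 eqxx.
have yy : 0 < dot y y by rewrite dot_gt0.
pose s := Num.sqrt (dot y y).
have s0 : s != 0 by rewrite gt_eqF// sqrtr_gt0.
have ss : s ^+ 2 = dot y y by rewrite sqr_sqrtr// ltW.
have [|M [MM yM ABM]] := AB (s^-1 *: y).
  by rewrite dotZl dotZr -ss; field.
have yMy : y *m M = y.
  by apply: (scalerI (_ : s^-1 != 0)); rewrite ?invr_eq0// scalemxAl.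
(* Passing to the preimage under [M], of equal volume, reduces the inequality to an inclusion. *)
rewrite -[leRHS](vol_orthogonal MM); last exact: (rv2_measurable_l y (mW _ mB)).
apply: le_vol.
- exact: (rv2_measurable_l y (mW _ mA)).
- have := rv2_measurable_l y (mW _ mB) => mWB.
  apply: (measurable_preimage_rv (f := fun t => row_of t *m M)) mWB _.
  by apply: measurable_mulmx_coord => i; exact: measurable_coord.
move=> x [Ax cxy]; split; last by rewrite -[y]yMy cone_orthogonal.
apply: ABM => //; rewrite dotZr exprMn exprVn ss.
by rewrite mulrC ltr_pdivrMr// -mulrA; case: cxy.
Qed.

End cones.

(** * Polar bodies *)

Section polar_level.
Context (R : realType) (n : nat).
Implicit Types K : set 'rV[R]_n.

(** For [r > 0] this is the dilate of [polar K] by [r]; level 1 is [polar K] by conversion. *)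
Definition polar_level (r : R) K : set 'rV[R]_n :=
  [set x | forall y, K y -> dot x y <= r].

Lemma closed_polar_level r K : closed (polar_level r K).
Proof.
rewrite (_ : polar_level r K = \bigcap_(y in K) ~` [set x | r < dot x y]).
  apply: closed_bigI => y _; rewrite closedC; apply: open_ltr.
    exact: cst_continuous.
  by apply: continuous_dot; [move=> x; exact: cvg_id|exact: cst_continuous].
by apply/seteqP; split => x xK y Ky; have := xK y Ky; rewrite /= leNgt => /negP.
Qed.

(** For small [e], the set [K] contains [e / 2] times each basis vector and its opposite; testing
    [x] against both bounds its coordinate by [r / (e / 2)]. *)
Lemma polar_level_coord_bounded r K : nbhs (0 : 'rV[R]_n) K ->
  exists M, forall x, polar_level r K x -> forall i, `|x 0 i| <= M.
Proof.
move=> /nbhs_rv[e e0 eK].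
have He (s : R) (i : 'I_n) : `|s| < e -> K (s *: delta_mx 0 i).
  move=> se; apply: eK => j; rewrite !mxE eqxx sub0r normrN /=.
  by case: eqP; rewrite ?mulr1// mulr0 normr0.
have dx (x : 'rV[R]_n) i s : dot x (s *: delta_mx 0 i) = s * x 0 i.
  rewrite dotZr dotE (bigD1 i)//= big1 ?addr0 => [|k ki].
    by rewrite mxE !eqxx mulr1.
  by rewrite mxE (negbTE ki) andbF mulr0.
have e20 : 0 < e / 2 by rewrite divr_gt0.
have e2e : e / 2 < e by rewrite ltr_pdivrMr// mulr_natr mulr2n ltrDl.
exists (r / (e / 2)) => x xK i.
have h1 := xK _ (He (e / 2) i _); have h2 := xK _ (He (- (e / 2)) i _).
rewrite normrN !gtr0_norm// !dx in h1 h2.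
rewrite ler_pdivlMr// -(gtr0_norm e20) -normrM ler_norml mulrC.
by rewrite h1// andbT lerNl -mulNr h2.
Qed.

Lemma compact_dot_bounded K : compact K ->
  exists2 S : R, 0 < S & forall y, K y -> forall xi, dot xi xi = 1 -> `|dot xi y| <= S.
Proof.
move=> /compact_bounded/ex_strict_bound_gt0[M M0 KM].
have K2 y : K y -> dot y y <= \sum_(i < n) M ^+ 2.
  move=> /KM /ltW yM; rewrite dotE; apply: ler_sum => i _.
  rewrite -expr2 -real_normK ?num_real// lerXn2r ?nnegrE// ?(ltW M0)//.
  apply: le_trans yM; rewrite [leRHS]mx_normrE.
  exact: (le_bigmax _ (fun ij => `|y ij.1 ij.2|) (0, i)).
(* With [s] the sum, Cauchy-Schwarz bounds the square of the product by [s], and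
   [s <= (1 + s) ^+ 2]; the 1 also ensures positivity. *)
exists (1 + \sum_(i < n) M ^+ 2).
  by rewrite ltr_pwDl// sumr_ge0// => i _; exact: sqr_ge0.
move=> y Ky xi xi1; set S := \sum_(i < n) _.
have S0 : 0 <= S by rewrite sumr_ge0// => i _; exact: sqr_ge0.
rewrite -(@ler_pXn2r _ 2)// ?nnegrE ?addr_ge0// real_normK ?num_real//.
apply: le_trans (cauchy_schwarz _ _) _; rewrite xi1 mul1r (le_trans (K2 _ Ky))//.
by rewrite -/S; nra.
Qed.

End polar_level.

(** * Comparison of the volumes of the polar bodies *)

Theorem theorem2 (R : realType) (n : nat) (hn : (2 <= n)%N)
    (K L : set 'rV[R]_n) (hK : convex_body K) (hL : convex_body L)
    (h0 : (K° `&` L°) 0)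
    (hproj : forall xi : 'rV[R]_n, sphere R n xi ->
      exists Phi : 'M[R]_n, SO_perp xi Phi /\
        (fun x => x *m Phi) @` (proj_perp xi @` K) `<=` proj_perp xi @` L) :
  (vol (polar K) >= vol (polar L))%E.
Proof.
case: hK => cK _ _; case: hL => cL _ _; case: h0 => K0 L0.
have [SK SK0 KS] := compact_dot_bounded cK.
have [SL SL0 LS] := compact_dot_bounded cL.
have mp (r : R) (C : set 'rV[R]_n) : rv_measurable (polar_level r C).
  exact: (closed_rv_measurable (@closed_polar_level R n r C)).
have [M LM] := polar_level_coord_bounded 1 L0.
have polar2 x : polar L x -> dot x x <= \sum_(i < n) M ^+ 2.
  move=> /LM xM; rewrite dotE; apply: ler_sum => i _.
  rewrite -expr2 -real_normK ?num_real// lerXn2r ?nnegrE//.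
  exact: le_trans (xM i).
have step e : 0 < e -> (vol (polar L `\ 0%R) <= vol (polar_level (1 + e) K `\ 0%R))%E.
  move=> e0; set N := \sum_(i < n) M ^+ 2 in polar2.
  have N0 : 0 <= N by rewrite sumr_ge0// => i _; exact: sqr_ge0.
  have N1 : 0 < N + 1 by rewrite ltr_wpDl.
  have S0 : 0 < SK + SL by rewrite addr_gt0.
  (* If [dot x xi] is below [t] in absolute value, the components of points of [K] and [L] along
     [xi] contribute an error of at most [SK * t + SL * t = e]. *)
  pose t := e / (SK + SL).
  have t0 : 0 < t by rewrite divr_gt0.
  (* On [polar L] the square norm is at most [N], so this aperture forces [dot x xi ^+ 2 < t ^+ 2];
     adding 1 keeps the divisor positive. *)
  apply: (@vol_le_of_slices _ _ (t ^+ 2 / (N + 1))) => //.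
  - by rewrite divr_gt0// exprn_gt0.
  - exact: (mp 1 L).
  move=> xi xi1.
  have [Phi [[[PP _] xiP] PKL]] : exists Phi, SO_perp xi Phi /\
      (fun x => x *m Phi) @` (proj_perp xi @` K) `<=` proj_perp xi @` L.
    by apply: hproj; rewrite /sphere /= /enorm xi1 sqrtr1.
  have PP' := mulmx1C PP.
  have xiPT : xi *m Phi^T = xi by rewrite -[in LHS]xiP -mulmxA PP mulmx1.
  (* On the dual side the transpose acts: [dot (x *m Phi^T) y = dot x (y *m Phi)]. *)
  exists Phi^T; split => //; first by rewrite trmxK.
  move=> x Lx xxi y Ky; rewrite dot_mulmxl trmxK.
  have [z Lz zE] : (proj_perp xi @` L) (proj_perp xi y *m Phi).
    by apply: PKL; exists (proj_perp xi y) => //; exists y.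
  have xt : `|dot x xi| < t.
    rewrite -(@ltr_pXn2r _ 2)// ?nnegrE// ?ltW// real_normK ?num_real//.
    apply: lt_le_trans xxi _; rewrite mulrAC ler_pdivrMr// ler_pM2l ?exprn_gt0//.
    by rewrite (le_trans (polar2 _ Lx))// lerDl.
  (* [Phi] fixes [xi], so [y *m Phi] keeps the [xi]-component of [y], while its projection is that
     of the point [z] of [L]. *)
  have yE : y *m Phi = z - dot z xi *: xi + dot y xi *: xi.
    by rewrite -/(proj_perp xi z) zE /proj_perp mulmxBl -scalemxAl xiP subrK.
  rewrite yE dotDr dotBr !dotZr.
  have xz : dot x z <= 1 := Lx z Lz.
  have h1 : - (dot z xi * dot x xi) <= SL * t.
    apply: le_trans (ler_norm _) _; rewrite normrN normrM.
    by apply: ler_pM => //; [rewrite dotC LS|exact: ltW].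
  have h2 : dot y xi * dot x xi <= SK * t.
    apply: le_trans (ler_norm _) _; rewrite normrM.
    by apply: ler_pM => //; [rewrite dotC KS|exact: ltW].
  have -> : e = SK * t + SL * t by rewrite -mulrDl /t mulrC divfK// gt_eqF.
  lra.
(* Every polar contains the origin, so restoring it adds the same term to both volumes. *)
have vol_polar0 (C : set 'rV[R]_n) :
    vol (polar C) = (vol (polar C `\ 0%R) + vol [set 0%R : 'rV[R]_n])%E.
  rewrite /vol (measureDI (@lebesgue_tuple R n) (mp 1 C) (@rv_measurable_set0 R n)).
  congr (_ + lebesgue_tuple _)%E.
  apply/seteqP; split => t /=; [by case|move=> tE]; split => // y _.
  rewrite (tE : row_of t = 0) dot0l.
  exact: ler01.
rewrite !vol_polar0 leeD2r//.
(* The sets [F k] decrease to [polar K] without the origin. Continuity from above needs [F 0], which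
   lies in level [1 + 1 = 2], to have finite volume. *)
have [M2 KM2] := polar_level_coord_bounded 2 K0.
pose F k := polar_level (1 + k.+1%:R^-1) K `\ 0.
have FE : \bigcap_k F k = polar K `\ 0.
  apply/seteqP; split => x; last first.
    move=> [xK x0] k _; split => // y Ky; apply: le_trans (xK y Ky) _.
    by rewrite lerDl invr_ge0.
  move=> xF; split; last by case: (xF 0).
  move=> y Ky; apply/ler_addgt0Pr => e e0.
  (* For this index [k], [k + 1 > 1 / e], so the excess [1 / (k + 1)] is below [e]. *)
  have [+ _] := xF (Num.truncn e^-1) I; move=> /(_ y Ky) h.
  apply: le_trans h _; rewrite lerD2l -[leRHS]invrK lef_pV2 ?posrE ?invr_gt0//.
  by rewrite ltW// truncnS_gt.
have mF k : rv_measurable (F k) by apply: rv_measurableD0; exact: mp.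
have Fcvg : vol (F k) @[k --> \oo] --> vol (polar K `\ 0).
  rewrite -FE (_ : vol (\bigcap_k F k) =
    lebesgue_tuple (\bigcap_k (row_of (n := n) @^-1` F k))); last first.
    by rewrite -preimage_bigcap.
  apply: (@nonincreasing_cvg_mu _ _ _ (@lebesgue_tuple R n)
    (fun k => row_of (n := n) @^-1` F k)) => //.
  - apply: (vol_lty (M := M2)); first exact: mF.
    move=> x [xF _]; apply: KM2 => y Ky; apply: le_trans (xF y Ky) _.
    by rewrite invr1.
  - by apply: bigcapT_measurable.
  - move=> i j ij; apply/subsetPset => t [tF t0]; split => // y Ky.
    apply: le_trans (tF y Ky) _; rewrite lerD2l lef_pV2 ?posrE// ler_nat ltnS.
    exact: ij.
rewrite -(cvg_lim _ Fcvg)//; apply: lime_ge.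
  by apply/cvg_ex; eexists; exact: Fcvg.
by apply: nearW => k; apply: step; rewrite invr_gt0.
Qed.
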